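(* Let $n,k\ge 1$ be integers and let $A_1,\dots,A_k,B_1,\dots,B_k\in\mathcal{M}_n(\mathbb{C})$ and $C=O_n$ (the zero matrix) be such that $\mathcal{N}=\{A_1,\dots,A_k,B_1,\dots,B_k,C\}$ is a commuting set of diagonalizable matrices. Let $S\in\mathfrak{S}(\mathcal{N})$ and let $\Gamma^S$ be the relevant matrix with respect to $S$. The following statements hold. (i) The vector space $$\mathcal{X}_h=S\{Y=[y_{rs}]\in\mathcal{M}_n(\mathbb{C})\mid y_{rs}=0\text{ if }\Gamma^S_{rs}\neq 0\}S^{-1}\subset\mathcal{M}_n(\mathbb{C})$$ is the set of solutions $X\in\mathcal{M}_n(\mathbb{C})$ of the homogeneous equation $\sum_{j=1}^kA_jXB_j=O_n$. Its dimension is equal to the number of zero entries of the relevant matrix $\Gamma^S$. (ii) If all off-diagonal elements of the relevant matrix $\Gamma^S$ are non-zero, then $\mathcal{N}\cup\mathcal{X}_h$ is a commuting set of diagonalizable matrices and all matrices in $\mathcal{X}_h$ are solutions of the standard linear matrix equation $\big(\sum_{j=1}^kA_jB_j\big)X=O_n$.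
   Context: $\mathcal{M}_n(\mathbb{C})$ is the set of complex $n\times n$ matrices. A set of matrices is commuting if any two of its elements commute. For a diagonalizable $M\in\mathcal{M}_n(\mathbb{C})$, $\mathfrak{S}(M)$ is the set of invertible $S\in\mathcal{M}_n(\mathbb{C})$ such that $S^{-1}MS$ is diagonal, and for $S\in\mathfrak{S}(M)$, $\Delta_M(S)\in\mathbb{C}^n$ is the vector $\mathbf{m}$ with $\mathrm{diag}(\mathbf{m})=S^{-1}MS$. For a set $\mathcal{N}$ of diagonalizable matrices, $\mathfrak{S}(\mathcal{N})=\bigcap_{M\in\mathcal{N}}\mathfrak{S}(M)$ (nonempty when $\mathcal{N}$ is a commuting set). For $S\in\mathfrak{S}(\mathcal{N})$ put $\mathbf{a}^j=\Delta_{A_j}(S)=(a^j_1,\dots,a^j_n)$ and $\mathbf{b}^j=\Delta_{B_j}(S)=(b^j_1,\dots,b^j_n)$; the relevant matrix with respect to $S$ is $\Gamma^S\in\mathcal{M}_n(\mathbb{C})$ with entries $\Gamma^S_{rs}=\sum_{j=1}^ka^j_rb^j_s$. *)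

(* Defs.v *)
From mathcomp Require Import all_boot all_order all_algebra.
From mathcomp Require Import classical_sets reals complex.

Set Implicit Arguments.
Unset Strict Implicit.
Unset Printing Implicit Defensive.

Import GRing.Theory.
Local Open Scope classical_set_scope.
Local Open Scope ring_scope.

Section Definitions.
Variables (F : fieldType) (n : nat).
Implicit Types (N : set 'M[F]_n) (M S X : 'M[F]_n).

Definition commuting_set N : Prop :=
  forall M M', N M -> N M' -> comm_mx M M'.

(* [diagonalizable M] asks for P \in unitmx with P *m M *m invmx P diagonal;
   the matrices S below are the inverses of such P. *)
Definition commuting_diagonalizable_set N : Prop :=
  commuting_set N /\ (forall M, N M -> diagonalizable M).

Definition diagonalizers M : set 'M[F]_n :=
  [set S | S \in unitmx /\ is_diag_mx (invmx S *m M *m S)].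

Definition set_diagonalizers N : set 'M[F]_n :=
  \bigcap_(M in N) diagonalizers M.

Definition Delta M S : 'rV[F]_n := \row_i (invmx S *m M *m S) i i.

Lemma diag_Delta M S :
  diagonalizers M S -> diag_mx (Delta M S) = invmx S *m M *m S.
Proof.
move=> [_ /is_diag_mxP Mdiag]; apply/matrixP => i j.
rewrite mxE /Delta mxE; have [<-|ij] := eqVneq i j; first by rewrite mulr1n.
by rewrite mulr0n [RHS]Mdiag.
Qed.

Variable k : nat.
Implicit Types A B : 'I_k -> 'M[F]_n.

Definition coef_set A B C : set 'M[F]_n := range A `|` range B `|` [set C].

Definition relevant_mx A B S : 'M[F]_n :=
  \matrix_(r, s) \sum_(j < k) Delta (A j) S 0 r * Delta (B j) S 0 s.

Definition homogeneous_space A B S : set 'M[F]_n :=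
  [set S *m Y *m invmx S | Y in
    [set Y : 'M[F]_n | forall r s, relevant_mx A B S r s != 0 -> Y r s = 0]].

End Definitions.

(* Main.v *)
(** Writing X = S Y S^-1 turns the operator X |-> sum_j A_j X B_j into the
entrywise product of Y with the relevant matrix, so X is a solution exactly
when Y is supported on the zero entries of that matrix. If those all lie on
the diagonal then S diagonalizes every solution as well; hence the solutions
commute with the B_j, and A_j X B_j = A_j B_j X. *)

Require Import Defs.
From mathcomp Require Import all_boot all_order all_algebra.
From mathcomp Require Import classical_sets reals complex.

Import GRing.Theory.
Local Open Scope classical_set_scope.
Local Open Scope ring_scope.
Local Open Scope complex_scope.

(** The matrix units at the positions in [P] form a basis of this space; [e] lists them along
    [enum_val], so the dimension is the number of positions. *)
Lemma support_vspace (F : fieldType) (m n : nat) (P : pred ('I_m * 'I_n)) :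
  exists V : {vspace 'M[F]_(m, n)},
    (forall Y : 'M[F]_(m, n),
       Y \in V <-> (forall r s, ~~ P (r, s) -> Y r s = 0)) /\
    \dim V = #|P|.
Proof.
pose e := [tuple delta_mx (enum_val i).1 (enum_val i).2 : 'M[F]_(m, n) | i < #|P|].
(* As [enum_val] is injective with values in [P], the right-hand sum has one term if [(r, s)] is in
   [P] and none otherwise. Freeness and the support condition both follow. *)
have coefE (c : 'I_#|P| -> F) r s :
    (\sum_i c i *: e`_i) r s = \sum_(i | enum_val i == (r, s)) c i.
  rewrite summxE [RHS]big_mkcond /=; apply: eq_bigr => i _.
  rewrite mxE -(tnth_nth 0 e i) tnth_mktuple mxE (eq_sym r) (eq_sym s) -xpair_eqE.
  by rewrite -surjective_pairing; case: eqP; rewrite ?mulr1 ?mulr0.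
exists <<e>>%VS; split=> [Y|]; last first.
  have /eqP -> : free e; last by rewrite size_tuple.
  apply/freeP => c c0 i; have := congr1 (fun Z : 'M_(m, n) =>
    Z (enum_val i).1 (enum_val i).2) c0.
  rewrite coefE -surjective_pairing mxE (big_pred1 i) // => j.
  exact: (inj_eq enum_val_inj).
split=> [/coord_span -> r s nPrs|Y0].
  rewrite coefE big_pred0 // => i; apply/eqP => Ei.
  by move: nPrs (enum_valP i); rewrite Ei => /negP.
(* In the expansion of [Y] in all matrix units, those outside [P] have coefficient zero and the
   others belong to [e]. *)
rewrite (matrix_sum_delta Y); apply: rpred_sum => r _; apply: rpred_sum => s _.
have [Prs|/Y0 ->] := boolP (P (r, s)); last by rewrite scale0r rpred0.
apply/rpredZ/memv_span/tnthP; exists (enum_rank_in Prs (r, s)).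
by rewrite tnth_mktuple enum_rankK_in.
Qed.

Section HomogeneousEquation.
Variables (F : fieldType) (n k : nat) (A B : 'I_k -> 'M[F]_n) (S : 'M[F]_n).
Hypothesis S_diag : set_diagonalizers (coef_set A B 0) S.
Hypothesis S_unit : S \in unitmx.

Local Lemma diagonalized M :
  coef_set A B 0 M -> M = S *m diag_mx (Delta M S) *m invmx S.
Proof.
by move=> /S_diag /diag_Delta ->; rewrite !mulmxA mulmxV // mul1mx mulmxK.
Qed.

Local Lemma coef_setA j : coef_set A B 0 (A j).
Proof. by left; left; exists j. Qed.

Local Lemma coef_setB j : coef_set A B 0 (B j).
Proof. by left; right; exists j. Qed.

Local Lemma conj_mulmx (M N : 'M[F]_n) :
  (S *m M *m invmx S) *m (S *m N *m invmx S) = S *m (M *m N) *m invmx S.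
Proof. by rewrite !mulmxA mulmxKV. Qed.

Local Lemma conj_inj (M N : 'M[F]_n) :
  S *m M *m invmx S = S *m N *m invmx S -> M = N.
Proof.
move=> /(congr1 (fun Z => invmx S *m Z *m S)).
by rewrite !mulmxA mulVmx // !mul1mx !mulmxKV.
Qed.

(** Once the inner factors [S] and [invmx S] cancel, entry (r, s) of the j-th middle factor is a^j_r
    Y_rs b^j_s, and Y_rs factors out of the sum over j. *)
Lemma homogeneous_lhsE (Y : 'M[F]_n) :
  \sum_j A j *m (S *m Y *m invmx S) *m B j =
  S *m (\matrix_(r, s) (relevant_mx A B S r s * Y r s)) *m invmx S.
Proof.
transitivity (\sum_j S *m (diag_mx (Delta (A j) S) *m Y *m
                           diag_mx (Delta (B j) S)) *m invmx S).
  apply: eq_bigr => j _.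
  rewrite {1}(diagonalized _ (coef_setA j)) {1}(diagonalized _ (coef_setB j)).
  by rewrite !conj_mulmx.
rewrite -mulmx_suml -mulmx_sumr; congr (_ *m _ *m _).
apply/matrixP => r s; rewrite summxE [RHS]mxE [relevant_mx _ _ _ _ _]mxE mulr_suml.
by apply: eq_bigr => j _; rewrite mul_mx_diag mxE mul_diag_mx mxE mulrAC.
Qed.

Lemma homogeneous_spaceE :
  homogeneous_space A B S = [set X | \sum_j A j *m X *m B j = 0].
Proof.
apply/seteqP; split=> [_ [Y Y0 <-]|X /= X0].
  rewrite /= homogeneous_lhsE (_ : \matrix_(_, _) _ = 0) ?mulmx0 ?mul0mx //.
  apply/matrixP => r s; rewrite mxE [RHS]mxE.
  by have [->|/Y0 ->] := eqVneq (relevant_mx A B S r s) 0; rewrite ?mul0r ?mulr0.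
pose Y := invmx S *m X *m S.
have XE : S *m Y *m invmx S = X by rewrite !mulmxA mulmxV // mul1mx mulmxK.
exists Y => // r s Grs; move: X0; rewrite -XE homogeneous_lhsE.
(* The zero on the right is written as S 0 S^-1, so that the conjugation can be cancelled and
   entries compared. *)
rewrite -[RHS](mul0mx _ (invmx S)) -[X in _ = X *m _](mulmx0 _ S) => /conj_inj.
move=> /matrixP /(_ r s); rewrite mxE [RHS]mxE => /eqP.
by rewrite mulf_eq0 (negPf Grs) => /eqP.
Qed.

(** Conjugation by [S] is linear and injective, so it carries the space of matrices supported on the
    zero entries to a space of the same dimension. *)
Lemma homogeneous_space_dim : exists V : {vspace 'M[F]_n},
  [set X | X \in V] = homogeneous_space A B S /\
  \dim V = #|[pred rs : 'I_n * 'I_n | relevant_mx A B S rs.1 rs.2 == 0]|.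
Proof.
have [V [VP <-]] := support_vspace F n n
  [pred rs : 'I_n * 'I_n | relevant_mx A B S rs.1 rs.2 == 0].
pose f := linfun (mulmxr (invmx S) \o mulmx S : 'M[F]_n -> 'M[F]_n).
have fE Y : f Y = S *m Y *m invmx S by rewrite lfunE.
exists (f @: V)%VS; split.
  apply/seteqP; split=> [X /memv_imgP[Y YV ->]|_ [Y Y0 <-]].
    by exists Y; rewrite ?fE //; move/VP: YV.
  by rewrite /= -fE; apply/memv_img/VP.
(* The image keeps the dimension because [V] meets the kernel of [f] only in 0. *)
apply/limg_dim_eq/eqP; rewrite -subv0; apply/subvP => Y.
rewrite memv_cap memv_ker memv0 fE => /andP[_ /eqP fY0].
by apply/eqP/conj_inj; rewrite fY0 mulmx0 mul0mx.
Qed.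

Hypothesis offdiag : forall r s, r != s -> relevant_mx A B S r s != 0.

(** One [S] serves for coefficients and solutions alike: under [offdiag] the matrix Y behind a
    solution vanishes off the diagonal. *)
Local Lemma conj_diag M : (coef_set A B 0 `|` homogeneous_space A B S) M ->
  exists d, M = S *m diag_mx d *m invmx S.
Proof.
case=> [/diagonalized -> |[Y Y0 <-]]; first by eexists.
have /is_diag_mxP/diag_mxP[d ->] : forall r s : 'I_n, r != s :> nat -> Y r s = 0.
  by move=> r s rs; apply/Y0/offdiag.
by exists d.
Qed.

Lemma commuting_diagonalizable_homogeneous :
  commuting_diagonalizable_set (coef_set A B 0 `|` homogeneous_space A B S).
Proof.
split=> [M N /conj_diag[d ->] /conj_diag[d' ->]|M /conj_diag[d ->]].
  by rewrite /comm_mx !conj_mulmx diag_mxC.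
exists (invmx S); first by rewrite unitmx_inv.
apply/similar_diagPex; exists d; apply/similarP.
  by rewrite unitmx_inv.
by rewrite !mulmxA mulVmx // mul1mx.
Qed.

Lemma homogeneous_sub_standard X :
  homogeneous_space A B S X -> (\sum_j A j *m B j) *m X = 0.
Proof.
move=> hX; have [comm _] := commuting_diagonalizable_homogeneous.
(* Replacing 0 by the sum of the A_j X B_j leaves a termwise comparison, settled by B_j X = X
   B_j. *)
move: (hX); rewrite homogeneous_spaceE /= => X0; rewrite -[RHS]X0.
rewrite mulmx_suml; apply: eq_bigr => j _.
rewrite -!mulmxA; congr (_ *m _); apply: comm; last by right.
by left; apply: coef_setB.
Qed.

End HomogeneousEquation.

Theorem lemma2p3 (R : realType) (n k : nat) (hn : (0 < n)%N) (hk : (0 < k)%N)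
    (A B : 'I_k -> 'M[R[i]]_n)
    (hN : commuting_diagonalizable_set (coef_set A B 0))
    (S : 'M[R[i]]_n) (hS : set_diagonalizers (coef_set A B 0) S) :
  (homogeneous_space A B S = [set X : 'M[R[i]]_n | \sum_(j < k) A j *m X *m B j = 0] /\
   exists V : {vspace 'M[R[i]]_n},
     [set X | X \in V] = homogeneous_space A B S /\
     \dim V = #|[pred rs : 'I_n * 'I_n | relevant_mx A B S rs.1 rs.2 == 0]|) /\
  ((forall r s : 'I_n, r != s -> relevant_mx A B S r s != 0) ->
   commuting_diagonalizable_set (coef_set A B 0 `|` homogeneous_space A B S) /\
   forall X : 'M[R[i]]_n, homogeneous_space A B S X ->
     (\sum_(j < k) A j *m B j) *m X = 0).
Proof.
(* Invertibility of [S] is read off from the member C = 0 of the set. *)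
have [S_unit _] : diagonalizers 0 S by apply: hS; right.
split; first by split; [exact: homogeneous_spaceE | exact: homogeneous_space_dim].
move=> offdiag; split; first exact: commuting_diagonalizable_homogeneous.
exact: homogeneous_sub_standard.
Qed.
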